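(* Let $A\subseteq\{0,1\}^m$ with $|A|=n$. The AMMRS-algorithm runs in time $O(mn)$ and finds the hidden element $a\in A$ with at most $${\rm DEN}(A)\cdot\ln n\le\min((\ln 2){\rm DEN}(A),\ln n)\cdot{\rm OPT}(A)\le\min((\ln 2)({\rm ETD}(A)+1),\ln n)\cdot{\rm OPT}(A)$$ queries.
   Context: A hidden $a\in A$ is to be identified using queries ''what is $a_i$?'' ($i\in[m]$). The AMMRS-algorithm maintains the set $B$ of elements of $A$ consistent with the answers so far (initially $B=A$); while $|B|\ge 2$ it queries an index $j$ maximizing $\min(|B_{j,0}|,|B_{j,1}|)$, where $B_{j,\xi}=\{b\in B\mid b_j=\xi\}$, and replaces $B$ by $B_{j,a_j}$. ${\rm OPT}(A)$ is the minimum depth of a decision tree for $A$ (equivalently, the optimal worst-case number of such queries). For $B\subseteq\{0,1\}^m$, ${\rm MAMI}(B)=\max_{j\in[m]}\min(|B_{j,0}|,|B_{j,1}|)$, and ${\rm DEN}(A)=\max_{B\subseteq A}\frac{|B|-1}{{\rm MAMI}(B)}$ (subsets with $|B|\le 1$ contribute $0$). For $h\in\{0,1\}^m$, a specifying set for $h$ with respect to $A$ is $S\subseteq[m]$ such that at most one $a\in A$ agrees with $h$ on all of $S$; ${\rm ETD}(A)=\max_h$ of the minimum size of such a set.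
   Formalization: For n = 2 the bound DEN(A)·ln n fails (one query, but DEN(A) ln 2 = ln 2 < 1); it is asserted for n ≠ 2, and for all n with DEN(A)·ln n rounded up to an integer. The O(mn) time claim is stated for m ≥ 1. *)

(* Defs.v *)
From HB Require Import structures.
From mathcomp Require Import all_boot all_order all_algebra.
From mathcomp Require Import boolp reals exp.

Set Implicit Arguments.
Unset Strict Implicit.
Unset Printing Implicit Defensive.

Import Order.TTheory GRing.Theory Num.Theory.

Definition bits (m : nat) := {ffun 'I_m -> bool}.

Definition restrict (m : nat) (B : {set bits m}) (j : 'I_m) (x : bool) :
  {set bits m} := [set b in B | b j == x].

Definition minsplit (m : nat) (B : {set bits m}) (j : 'I_m) : nat :=
  minn #|restrict B j false| #|restrict B j true|.

Definition MAMI (m : nat) (B : {set bits m}) : nat :=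
  \max_(j < m) minsplit B j.

(* The terms are nonnegative, and B = set0 contributes 0, so the initial value
   0 of the maximum is harmless.  When 1 < #|B| some index separates two
   elements of B, so that the denominator is positive. *)
Definition DEN (R : realType) (m : nat) (A : {set bits m}) : R :=
  (\big[Num.max/0]_(B : {set bits m} | B \subset A)
     (if (1 < #|B|)%N then (#|B|%:R - 1) / (MAMI B)%:R else 0))%R.

Definition specifying (m : nat) (A : {set bits m}) (h : bits m)
    (S : {set 'I_m}) : bool :=
  #|[set a in A | [forall j in S, a j == h j]]| <= 1.

(* [set: 'I_m] is always specifying. *)
Definition ETD (m : nat) (A : {set bits m}) : nat :=
  \max_(h : bits m)
    #|[arg min_(S < [set: 'I_m] | specifying A h S) #|S| ]|.

Inductive dtree (m : nat) : Type :=
| Leaf (b : bits m)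
| Node (j : 'I_m) (t0 t1 : dtree m).

Fixpoint dt_eval (m : nat) (t : dtree m) (a : bits m) : bits m :=
  match t with
  | Leaf b => b
  | Node j t0 t1 => if a j then dt_eval t1 a else dt_eval t0 a
  end.

Fixpoint depth (m : nat) (t : dtree m) : nat :=
  match t with
  | Leaf _ => 0
  | Node _ t0 t1 => (maxn (depth t0) (depth t1)).+1
  end.

Definition dtree_for (m : nat) (A : {set bits m}) (t : dtree m) : Prop :=
  forall a, a \in A -> dt_eval t a = a.

Fixpoint full_dtree (m : nat) (js : seq 'I_m) (b : bits m) : dtree m :=
  match js with
  | [::] => Leaf b
  | j :: js' =>
      Node j (full_dtree js' [ffun i => if i == j then false else b i])
             (full_dtree js' [ffun i => if i == j then true else b i])
  end.

Lemma full_dtreeE (m : nat) (js : seq 'I_m) (b a : bits m) :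
  dt_eval (full_dtree js b) a = [ffun i => if i \in js then a i else b i].
Proof.
elim: js b => [|j js IH] b /=; first by apply/ffunP=> i; rewrite ffunE.
have -> : (if a j then dt_eval (full_dtree js [ffun i => if i == j then true else b i]) a
           else dt_eval (full_dtree js [ffun i => if i == j then false else b i]) a)
  = dt_eval (full_dtree js [ffun i => if i == j then a j else b i]) a.
  by case: (a j).
rewrite IH; apply/ffunP=> i; rewrite !ffunE inE.
by case: eqVneq => [->|]; case: ifP.
Qed.

Lemma dtree_depth_exists (m : nat) (A : {set bits m}) :
  exists d, `[< exists2 t, dtree_for A t & depth t = d >].
Proof.
pose t := full_dtree (enum 'I_m) [ffun=> false].
exists (depth t); apply/asboolP; exists t => // a _.
by rewrite full_dtreeE; apply/ffunP=> i; rewrite ffunE mem_enum.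
Qed.

Definition OPT (m : nat) (A : {set bits m}) : nat :=
  ex_minn (dtree_depth_exists A).

(* One round of the algorithm; every way of breaking ties is allowed. *)
Definition ammrs_step (m : nat) (a : bits m) (B : {set bits m}) (j : 'I_m)
    (B' : {set bits m}) : Prop :=
  [/\ 2 <= #|B|,
      forall k, minsplit B k <= minsplit B j
    & B' = restrict B j (a j)].

(* [ammrs a B js B']: with hidden element [a], a possibly unfinished execution
   started from the candidate set [B] asks the queries [js] in this order and
   reaches [B'].  The algorithm stops exactly when #|B'| <= 1. *)
Inductive ammrs (m : nat) (a : bits m) :
  {set bits m} -> seq 'I_m -> {set bits m} -> Prop :=
| ammrs_nil B : ammrs a B [::] B
| ammrs_cons B j B' js B'' :
    ammrs_step a B j B' -> ammrs a B' js B'' -> ammrs a B (j :: js) B''.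

(* Running time is measured on a random access machine with finitely many
   registers and arrays (those named in a fixed program), programmed in a
   structured language.  Every command, every test and every node of an
   expression costs one unit; the only arithmetic is addition and truncated
   subtraction, and a test succeeds when the value is nonzero.  A command that
   would store a value >= [W] in a register or an array is stuck, so [W]
   bounds the machine words.  The hidden element is accessible only through
   [Query]. *)
Inductive expr : Type :=
| Const (k : nat)
| Reg (x : nat)
| Read (r : nat) (e : expr)
| Add (e1 e2 : expr)
| Sub (e1 e2 : expr).

Inductive cmd : Type :=
| Skip
| Assign (x : nat) (e : expr)
| Store (r : nat) (e1 e2 : expr)
| Query (x : nat) (e : expr)
| Seq (c1 c2 : cmd)
| If (e : expr) (c1 c2 : cmd)
| While (e : expr) (c : cmd).

Record state : Type := State { reg : nat -> nat; arr : nat -> nat -> nat }.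

Definition set_reg (st : state) (x v : nat) : state :=
  State (fun y => if y == x then v else reg st y) (arr st).

Definition set_arr (st : state) (r p v : nat) : state :=
  State (reg st)
    (fun r' p' => if (r' == r) && (p' == p) then v else arr st r' p').

Fixpoint eval (st : state) (e : expr) : nat :=
  match e with
  | Const k => k
  | Reg x => reg st x
  | Read r e1 => arr st r (eval st e1)
  | Add e1 e2 => eval st e1 + eval st e2
  | Sub e1 e2 => eval st e1 - eval st e2
  end.

Fixpoint ecost (e : expr) : nat :=
  match e with
  | Const _ | Reg _ => 1
  | Read _ e1 => (ecost e1).+1
  | Add e1 e2 | Sub e1 e2 => (ecost e1 + ecost e2).+1
  end.

(* [exec W a c st t js st']: with words bounded by [W] and hidden element [a],
   the command [c] started in [st] halts in [st'] after [t] time units, having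
   asked the queries [js] in this order. *)
Inductive exec (W m : nat) (a : bits m) :
  cmd -> state -> nat -> seq 'I_m -> state -> Prop :=
| exec_skip st : exec W a Skip st 1 [::] st
| exec_assign x e st :
    eval st e < W ->
    exec W a (Assign x e) st (ecost e).+1 [::] (set_reg st x (eval st e))
| exec_store r e1 e2 st :
    eval st e2 < W ->
    exec W a (Store r e1 e2) st (ecost e1 + ecost e2).+1 [::]
      (set_arr st r (eval st e1) (eval st e2))
| exec_query x e st (j : 'I_m) :
    eval st e = j -> a j < W ->
    exec W a (Query x e) st (ecost e).+1 [:: j] (set_reg st x (a j))
| exec_seq c1 c2 st t1 js1 st1 t2 js2 st2 :
    exec W a c1 st t1 js1 st1 -> exec W a c2 st1 t2 js2 st2 ->
    exec W a (Seq c1 c2) st (t1 + t2).+1 (js1 ++ js2) st2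
| exec_if e c1 c2 st t js st1 :
    exec W a (if eval st e != 0 then c1 else c2) st t js st1 ->
    exec W a (If e c1 c2) st (ecost e + t).+1 js st1
| exec_while_stop e c st :
    eval st e = 0 -> exec W a (While e c) st (ecost e).+1 [::] st
| exec_while_loop e c st t1 js1 st1 t2 js2 st2 :
    eval st e != 0 ->
    exec W a c st t1 js1 st1 -> exec W a (While e c) st1 t2 js2 st2 ->
    exec W a (While e c) st (ecost e + t1 + t2).+1 (js1 ++ js2) st2.

(* Registers 0 and 1 hold m and n; array 0 holds the n x m bit matrix whose
   rows are the elements of [s], in row-major order; all the rest is 0. *)
Definition input_state (m : nat) (s : seq (bits m)) : state :=
  State (fun x => nth 0 [:: m; size s] x)
    (fun r p =>
       if r == 0 then nth 0 [seq nat_of_bool (b j) | b : bits m <- s, j : 'I_m <- enum 'I_m] p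
       else 0).

(* Main.v *)
(** Let D = DEN A.  One round replaces |B| - 1 by at most
    |B| - 1 - MAMI(B), where MAMI(B) >= max (1, (|B| - 1) / D).  The number of
    rounds is therefore bounded by any potential F of |B| - 1 that drops by at
    least 1 under every such decrease.  For D >= 3 the potential is linear up to
    D and logarithmic beyond; for 2 <= D < 3, where the constants are too tight
    for this, it is tabulated up to 6 and is D * ln |B| beyond.  Since any three
    elements form a set with MAMI 1, D >= 2 as soon as n >= 3.

    For the running time, the program keeps for every column the number of
    candidates having a one there.  A round then costs O(m) to find the best
    column and O(n) to scan the rows, plus O(m) for each discarded row.  A
    queried column splits the candidates and is never queried again, so there
    are at most min (m, n) rounds. *)

Require Import Defs.
From HB Require Import structures.
From mathcomp Require Import all_boot all_order all_algebra.
From mathcomp Require Import boolp reals sequences exp.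
From mathcomp Require Import zify ring lra.

Set Implicit Arguments.
Unset Strict Implicit.
Unset Printing Implicit Defensive.

Local Notation Sub := Defs.Sub.

(** * Weakest preconditions that record time and queries *)

Definition wp (W m : nat) (a : bits m) (c : cmd)
    (Q : nat -> seq 'I_m -> state -> Prop) (st : state) : Prop :=
  exists t js st', exec W a c st t js st' /\ Q t js st'.

Lemma wp_weaken (W m : nat) (a : bits m) c (P Q : nat -> seq 'I_m -> state -> Prop) st :
  wp W a c P st -> (forall t js st', P t js st' -> Q t js st') -> wp W a c Q st.
Proof. by move=> [t [js [st' [? /[swap] PQ /PQ ?]]]]; exists t, js, st'. Qed.

Lemma wp_skip (W m : nat) (a : bits m) (Q : nat -> seq 'I_m -> state -> Prop) st :
  Q 1 [::] st -> wp W a Skip Q st.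
Proof. by move=> ?; exists 1, [::], st; split=> //; constructor. Qed.

Lemma wp_assign (W m : nat) (a : bits m) x e (Q : nat -> seq 'I_m -> state -> Prop) st :
  eval st e < W -> Q (ecost e).+1 [::] (set_reg st x (eval st e)) ->
  wp W a (Assign x e) Q st.
Proof. by move=> ? ?; do 3!eexists; split; [constructor|]. Qed.

Lemma wp_store (W m : nat) (a : bits m) r e1 e2 (Q : nat -> seq 'I_m -> state -> Prop) st :
  eval st e2 < W ->
  Q (ecost e1 + ecost e2).+1 [::] (set_arr st r (eval st e1) (eval st e2)) ->
  wp W a (Store r e1 e2) Q st.
Proof. by move=> ? ?; do 3!eexists; split; [constructor|]. Qed.

Lemma wp_query (W m : nat) (a : bits m) x e (j : 'I_m)
    (Q : nat -> seq 'I_m -> state -> Prop) st :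
  eval st e = j -> a j < W -> Q (ecost e).+1 [:: j] (set_reg st x (a j)) ->
  wp W a (Query x e) Q st.
Proof. by move=> ? ? ?; do 3!eexists; split; [constructor; eassumption|]. Qed.

Lemma wp_seq (W m : nat) (a : bits m) c1 c2 (Q : nat -> seq 'I_m -> state -> Prop) st :
  wp W a c1 (fun t1 js1 =>
    wp W a c2 (fun t2 js2 => Q (t1 + t2).+1 (js1 ++ js2))) st ->
  wp W a (Seq c1 c2) Q st.
Proof.
move=> [t1 [js1 [st1 [? [t2 [js2 [st2 [? ?]]]]]]]].
by do 3!eexists; split; [econstructor; eassumption|].
Qed.

Lemma wp_if (W m : nat) (a : bits m) e c1 c2 (Q : nat -> seq 'I_m -> state -> Prop) st :
  wp W a (if eval st e != 0 then c1 else c2) (fun t => Q (ecost e + t).+1) st ->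
  wp W a (If e c1 c2) Q st.
Proof.
by move=> [t [js [st' [? ?]]]]; do 3!eexists; split; [constructor; eassumption|].
Qed.

(* The invariant also records the time spent and the queries asked since the
   loop was entered. *)
Lemma wp_while (W m : nat) (a : bits m) e c (I Q : nat -> seq 'I_m -> state -> Prop)
    (mu : state -> nat) st :
  I 0 [::] st ->
  (forall T js st1, I T js st1 -> eval st1 e != 0 ->
     wp W a c (fun t js' st2 =>
       I (T + (ecost e + t).+1) (js ++ js') st2 /\ mu st2 < mu st1) st1) ->
  (forall T js st1, I T js st1 -> eval st1 e = 0 -> Q (T + (ecost e).+1) js st1) ->
  wp W a (While e c) Q st.
Proof.
move=> I0 IS IQ.
(* The time [T] and the queries [js] accumulate over the iterations, so the claim is generalised
   over both and proved by induction on a bound [k] for [mu]. *)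
suff H k T js st1 : mu st1 < k -> I T js st1 ->
    wp W a (While e c) (fun t js' => Q (T + t) (js ++ js')) st1.
  by have /= := H _ 0 [::] st (ltnSn _) I0.
elim: k T js st1 => // k IH T js st1 lek I1.
have [e0|e0] := eqVneq (eval st1 e) 0.
  by exists (ecost e).+1, [::], st1; rewrite cats0; split; [constructor|apply: IQ].
have [t2 [js2 [st2 [X2 [I2 mu2]]]]] := IS _ _ _ I1 e0.
have [|t3 [js3 [st3 [X3 Q3]]]] := IH _ _ _ _ I2; first by lia.
do 3!eexists; split; first exact: exec_while_loop e0 X2 X3.
by rewrite catA; move: Q3; congr (Q _ _ _); lia.
Qed.

(** * The program and its inner loop *)

Definition incr x := Assign x (Add (Reg x) (Const 1)).

(** [op] is [Add] while the column counts are built up and [Sub] when a row is discarded. *)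
Definition row_loop (op : expr -> expr -> expr) : cmd :=
  Seq (Assign 4 (Const 0))
    (While (Sub (Reg 0) (Reg 4))
       (Seq (Store 1 (Reg 4)
               (op (Read 1 (Reg 4)) (Read 0 (Add (Reg 3) (Reg 4)))))
            (incr 4))).

(** The machine cannot multiply, so the row offset advances by [m] along with the row index. *)
Definition next_row : cmd :=
  Seq (incr 2) (Assign 3 (Add (Reg 3) (Reg 0))).

Definition init : cmd :=
  Seq (Assign 5 (Reg 1))
    (While (Sub (Reg 1) (Reg 2)) (Seq (row_loop Add) next_row)).

(** Truncated subtraction yields the smaller of [x] and [y] as [x - (x - y)], here for the numbers
    of ones and zeros in a column. *)
Definition argmax : cmd :=
  Seq (Assign 4 (Const 0)) (Seq (Assign 6 (Const 0))
    (While (Sub (Reg 0) (Reg 4))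
      (Seq (Assign 8 (Sub (Read 1 (Reg 4))
                       (Sub (Read 1 (Reg 4)) (Sub (Reg 5) (Read 1 (Reg 4))))))
      (Seq (If (Sub (Reg 8) (Reg 6))
              (Seq (Assign 6 (Reg 8)) (Assign 7 (Reg 4))) Skip)
           (incr 4))))).

(** The two truncated differences add up to the absolute difference of the bit and the answer. *)
Definition bit_differs : expr :=
  Add (Sub (Read 0 (Add (Reg 3) (Reg 7))) (Reg 8))
      (Sub (Reg 8) (Read 0 (Add (Reg 3) (Reg 7)))).

Definition scan : cmd :=
  Seq (Assign 2 (Const 0)) (Seq (Assign 3 (Const 0))
    (While (Sub (Reg 1) (Reg 2))
      (Seq (If (Read 2 (Reg 2)) Skip
             (If bit_differs
               (Seq (Store 2 (Reg 2) (Const 1))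
                 (Seq (Assign 5 (Sub (Reg 5) (Const 1))) (row_loop Sub)))
               Skip))
           next_row))).

(* Registers: 2 row index, 3 offset of that row in array 0, 4 column index,
   5 number of candidates, 6 best split so far, 7 its column, 8 scratch value
   and then the answer.  Array 1 counts, for each column, the candidates with a
   one there; array 2 marks the discarded rows. *)
Definition ammrs_prog : cmd :=
  Seq init
    (Seq (While (Sub (Reg 5) (Const 1))
            (Seq argmax (Seq (Query 8 (Reg 7)) scan)))
      (Seq (Assign 2 (Const 0))
        (Seq (While (Read 2 (Reg 2)) (incr 2)) (Assign 0 (Reg 2))))).

(** One iteration costs exactly 18 units; the initial assignment, the final test and the sequencing
    add 7. *)
Lemma wp_row_loop (W m : nat) (a : bits m) (op : expr -> expr -> expr)
    (f : nat -> nat -> nat) (Q : nat -> seq 'I_m -> state -> Prop) st :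
  (forall st' e1 e2, eval st' (op e1 e2) = f (eval st' e1) (eval st' e2)) ->
  (forall e1 e2, ecost (op e1 e2) = (ecost e1 + ecost e2).+1) ->
  reg st 0 = m -> m < W ->
  (forall j : 'I_m, f (arr st 1 j) (arr st 0 (reg st 3 + j)) < W) ->
  (forall t st', t <= 18 * m + 7 ->
     (forall x, x != 4 -> reg st' x = reg st x) ->
     (forall r p, r != 1 -> arr st' r p = arr st r p) ->
     (forall j : 'I_m, arr st' 1 j = f (arr st 1 j) (arr st 0 (reg st 3 + j))) ->
     Q t [::] st') ->
  wp W a (row_loop op) Q st.
Proof.
move=> evE costE r0 mW fW HQ.
apply: wp_seq; apply: wp_assign => /=; first lia.
pose I (T : nat) (js : seq 'I_m) (st' : state) :=
  [/\ js = [::], reg st' 4 <= m, T <= 18 * reg st' 4 &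
   [/\ forall x, x != 4 -> reg st' x = reg st x,
     forall r p, r != 1 -> arr st' r p = arr st r p &
     forall j : 'I_m, arr st' 1 j =
       if j < reg st' 4 then f (arr st 1 j) (arr st 0 (reg st 3 + j))
       else arr st 1 j]].
apply: (wp_while (I := I) (mu := fun s => m - reg s 4)).
- by split=> //=; split=> // x /negPf ->.
- move=> T js st1 [-> le1 TT [h1 h2 h3]] /=; rewrite h1 // r0 => lt1.
  have {}lt1 : reg st1 4 < m by lia.
  have jE := h3 (Ordinal lt1); rewrite /= ltnn in jE.
  have fE : eval st1 (op (Read 1 (Reg 4)) (Read 0 (Add (Reg 3) (Reg 4)))) =
            f (arr st 1 (reg st1 4)) (arr st 0 (reg st 3 + reg st1 4)).
    by rewrite evE /= jE (h1 3) // h2.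
  apply: wp_seq; apply: wp_store; rewrite fE; first exact: fW (Ordinal lt1).
  apply: wp_assign => /=; first lia.
  rewrite costE; split; last by lia.
  split=> //=; [lia|lia|split].
  + by move=> x /negPf xE; rewrite xE h1 ?xE.
  + by move=> r p /negPf rE; rewrite rE /= h2 ?rE.
  + move=> j; rewrite addn1 ltnS [j <= _]leq_eqVlt.
    by have [->|ne] := eqVneq; rewrite //= h3.
- move=> T js st1 [-> le1 TT [h1 h2 h3]] /=; rewrite h1 // r0 => ge1.
  apply: HQ => //; first by lia.
  by move=> j; rewrite h3 (leq_trans (ltn_ord j)) //; lia.
Qed.

(* [simpl] changes the type annotations inside cardinals, which [lia] then takes
   for distinct atoms. *)
Ltac slia := unfold reverse_coercion in *; simpl in *; lia.

(** * Input encoding and splits of candidate sets *)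

Lemma flatten_bits_nth (m : nat) (b0 : bits m) (s : seq (bits m)) i (j : 'I_m) :
  i < size s ->
  nth 0 [seq nat_of_bool (b j) | b : bits m <- s, j : 'I_m <- enum 'I_m] (i * m + j)
  = nth b0 s i j.
Proof.
have szE (b : bits m) : size [seq nat_of_bool (b k) | k <- enum 'I_m] = m.
  by rewrite size_map size_enum_ord.
elim: s i => [|b s IH] [|i] //= lti; rewrite nth_cat szE.
  by rewrite mul0n add0n ltn_ord (nth_map j) ?size_enum_ord // nth_ord_enum.
rewrite ltnNge mulSn -addnA leq_addr /= addKn; exact: IH.
Qed.

Lemma in_restrict (m : nat) (B : {set bits m}) j x b :
  (b \in restrict B j x) = (b \in B) && (b j == x).
Proof. by rewrite inE. Qed.

Lemma restrict_sub (m : nat) (B : {set bits m}) j x : restrict B j x \subset B.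
Proof. by apply/subsetP=> b; rewrite in_restrict => /andP[]. Qed.

Lemma card_restrict (m : nat) (B : {set bits m}) j x :
  #|restrict B j x| + #|restrict B j (~~ x)| = #|B|.
Proof.
rewrite -(cardsID [set b : bits m | b j == x] B); congr addn; apply: eq_card => b.
  by rewrite !inE andbC.
by rewrite !inE andbC; case: (b j) x => [] [].
Qed.

Lemma minsplit_le (m : nat) (B : {set bits m}) j x : minsplit B j <= #|restrict B j x|.
Proof. by rewrite /minsplit; case: x; rewrite ?geq_minl ?geq_minr. Qed.

Lemma minsplit_gt0 (m : nat) (B : {set bits m}) :
  2 <= #|B| -> exists j, 0 < minsplit B j.
Proof.
move=> /card_gt1P [b [b' [bB b'B nb]]].
have [j nj] : exists j, b j != b' j.
  by apply/existsP; apply: contraNT nb => /existsPn nb; apply/eqP/ffunP=> j; apply/eqP/negPn.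
have gt0 : 0 < #|restrict B j (b j)|.
  by apply/card_gt0P; exists b; rewrite in_restrict bB eqxx.
have gt0' : 0 < #|restrict B j (b' j)|.
  by apply/card_gt0P; exists b'; rewrite in_restrict b'B eqxx.
exists j; rewrite /minsplit leq_min.
by case: (b j) (b' j) nj gt0 gt0' => [] [] // _ -> ->.
Qed.

Lemma card_restrictD1 (m : nat) (B : {set bits m}) (b : bits m) j :
  b \in B -> #|restrict (B :\ b) j true| = #|restrict B j true| - b j.
Proof.
move=> bB; rewrite [in RHS](cardsD1 b) in_restrict bB /= eqb_id addKn.
by apply: eq_card => b'; rewrite !inE andbA.
Qed.

(** The inductive definition puts new queries in front, whereas the main loop of the program extends
    a run at its end. *)
Lemma ammrs_rcons (m : nat) (a : bits m) A js B j B' :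
  ammrs a A js B -> ammrs_step a B j B' -> ammrs a A (rcons js j) B'.
Proof.
elim=> [C|C k C' ks C'' st _ IH] H /=.
  by econstructor; [exact: H|constructor].
by econstructor; [exact: st|exact: IH].
Qed.

(** * Correctness and running time of the program *)

Record holds_candidates (m : nat) (a : bits m) (s : seq (bits m)) (B : {set bits m})
    (st : state) : Prop := HoldsCandidates {
  hc_m : reg st 0 = m;
  hc_n : reg st 1 = size s;
  hc_card : reg st 5 = #|B|;
  hc_input : forall i (j : 'I_m), i < size s -> arr st 0 (i * m + j) = nth a s i j;
  hc_count : forall j : 'I_m, arr st 1 j = #|restrict B j true|;
  hc_dead : forall i, i < size s -> (arr st 2 i == 0) = (nth a s i \in B) }.

(** Only registers 0, 1 and 5 enter the record, so assignments to the others preserve it. *)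
Lemma holds_candidates_frame (m : nat) (a : bits m) s B st st' :
  holds_candidates a s B st ->
  (forall x, x \in [:: 0; 1; 5] -> reg st' x = reg st x) ->
  arr st' = arr st ->
  holds_candidates a s B st'.
Proof. by case=> ? ? ? ? ? ? regE arrE; split; rewrite ?regE ?arrE. Qed.

Lemma wp_init (W m : nat) (a : bits m) (s : seq (bits m)) (A : {set bits m})
    (Q : nat -> seq 'I_m -> state -> Prop) :
  m < W -> size s < W -> size s * m < W -> uniq s -> s =i A ->
  (forall t st', t <= 18 * (size s * m) + 30 * size s + 10 ->
     holds_candidates a s A st' -> Q t [::] st') ->
  wp W a init Q (input_state s).
Proof.
move=> mW nW nmW us sA HQ.
have cardA : #|A| = size s by rewrite -(card_uniqP us); exact/esym/eq_card.
apply: wp_seq; apply: wp_assign => //=.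
pose I (T : nat) (js : seq 'I_m) (st : state) :=
  [/\ js = [::], reg st 2 <= size s, reg st 3 = reg st 2 * m,
    T <= 18 * (reg st 2 * m) + 30 * reg st 2 &
  [/\ reg st 0 = m, reg st 1 = size s, reg st 5 = size s,
    forall r p, r != 1 -> arr st r p = arr (input_state s) r p &
    forall j : 'I_m, arr st 1 j = count (fun b : bits m => b j) (take (reg st 2) s)]].
apply: (wp_while (I := I) (mu := fun st => size s - reg st 2)).
- split=> //; split=> // j; by rewrite take0.
- move=> T js st [-> le2 r3 TT [r0 r1 r5 rA rC]] /=; rewrite r1 => lt2.
  have {}lt2 : reg st 2 < size s by lia.
  have rE (j : 'I_m) : arr st 0 (reg st 3 + j) = nth a s (reg st 2) j.
    by rewrite rA //= r3 (flatten_bits_nth a).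
  apply: wp_seq; apply: (@wp_row_loop _ _ _ Add addn) => //.
    move=> j; rewrite rE rC; apply: leq_ltn_trans nW.
    have := count_size (fun b : bits m => b j) (take (reg st 2) s).
    rewrite size_take lt2; by case: (nth a s (reg st 2) j) => /=; lia.
  move=> t1 st1 t1E g1 h1 c1.
  (* The offset in register 3 ends at [size s * m], one past the matrix, and even this value must
     fit in a word. *)
  have leM : (reg st 2).+1 * m <= size s * m by rewrite leq_mul2r lt2 orbT.
  apply: wp_seq; apply: wp_assign => /=; rewrite !g1 //; first by lia.
  apply: wp_assign => /=; rewrite !g1 // r0 r3; first by rewrite mulSn in leM; lia.
  split; last by lia.
  split=> //=; rewrite ?g1 //; try lia.
  split=> //=; rewrite ?g1 //.
    by move=> r p r_neq1; rewrite h1 // rA.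
  move=> j; rewrite c1 rE rC addn1 (take_nth a lt2) -cats1 count_cat /=; lia.
- move=> T js st [-> le2 r3 TT [r0 r1 r5 rA rC]] /=; rewrite r1 => ge2.
  have r2 : reg st 2 = size s by lia.
  apply: HQ; first by rewrite r2 in TT; lia.
  split=> //.
  + by rewrite r5 cardA.
  + by move=> i j lti; rewrite rA //= (flatten_bits_nth a).
  + move=> j; rewrite rC r2 take_size -size_filter.
    rewrite -(card_uniqP (filter_uniq _ us)); apply: eq_card => b.
    by rewrite mem_filter in_restrict sA andbC eqb_id.
  + by move=> i lti; rewrite rA //= -sA mem_nth.
Qed.

Lemma wp_argmax (W m : nat) (a : bits m) (s : seq (bits m)) (B : {set bits m})
    (Q : nat -> seq 'I_m -> state -> Prop) st :
  m < W -> #|B| < W -> 2 <= #|B| -> holds_candidates a s B st ->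
  (forall t st' (j : 'I_m), t <= 50 * m + 20 ->
     holds_candidates a s B st' -> reg st' 7 = j ->
     (forall k, minsplit B k <= minsplit B j) -> Q t [::] st') ->
  wp W a argmax Q st.
Proof.
move=> mW BW B2 hcB HQ.
apply: wp_seq; apply: wp_assign => /=; first lia.
apply: wp_seq; apply: wp_assign => /=; first lia.
(* Register 7 names a best column only once a positive split has been seen; [minsplit_gt0]
   guarantees one by the end. *)
pose I (T : nat) (js : seq 'I_m) (st' : state) :=
  [/\ js = [::], reg st' 4 <= m, T <= 50 * reg st' 4, holds_candidates a s B st' &
    (forall k : 'I_m, k < reg st' 4 -> minsplit B k <= reg st' 6) /\
    (0 < reg st' 6 -> exists2 j : 'I_m, reg st' 7 = j & minsplit B j = reg st' 6)].
apply: (wp_while (I := I) (mu := fun st => m - reg st 4)).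
- split=> //; apply: holds_candidates_frame hcB _ _ => //= x.
  by rewrite !inE => /or3P[] /eqP->.
- move=> T js st1 [-> le4 TT hc [max1 arg1]] /=; rewrite (hc_m hc) => lt4.
  have {}lt4 : reg st1 4 < m by lia.
  pose j := Ordinal lt4.
  have splitE : arr st1 1 (reg st1 4) - (arr st1 1 (reg st1 4) -
      (reg st1 5 - arr st1 1 (reg st1 4))) = minsplit B j.
    rewrite (hc_count hc j) (hc_card hc) /minsplit -(card_restrict B j true) /=; lia.
  have split_le : minsplit B j <= #|B|.
    exact: leq_trans (minsplit_le B j true) (subset_leq_card (restrict_sub _ _ _)).
  apply: wp_seq; apply: wp_assign => /=; rewrite splitE; first lia.
  apply: wp_seq; apply: wp_if => /=.
  case: ifPn => [gt6|le6].
    apply: wp_seq; apply: wp_assign => /=; first lia.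
    apply: wp_assign => /=; first lia.
    apply: wp_assign => /=; first lia.
    split; last lia.
    split=> //=; [lia|lia| |split].
    + by apply: holds_candidates_frame hc _ _ => //= x; rewrite !inE => /or3P[] /eqP->.
    + move=> k; rewrite addn1 ltnS leq_eqVlt => /orP[/eqP kj|/max1]; last lia.
      by have -> : k = j by apply: val_inj.
    + by move=> _; exists j.
  apply: wp_skip; apply: wp_assign => /=; first lia.
  split; last lia.
  split=> //=; [lia|lia| |split=> //].
  + by apply: holds_candidates_frame hc _ _ => //= x; rewrite !inE => /or3P[] /eqP->.
  + move=> k; rewrite addn1 ltnS leq_eqVlt => /orP[/eqP kj|/max1]; last lia.
    have -> : k = j by apply: val_inj.
    lia.
- move=> T js st1 [-> le4 TT hc [max1 arg1]] /=; rewrite (hc_m hc) => ge4.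
  have {}max1 k : minsplit B k <= reg st1 6.
    by apply: max1; rewrite (leq_trans (ltn_ord k)); lia.
  have [k k_gt0] := minsplit_gt0 B2.
  have [|j r7 jE] := arg1; first exact: leq_trans k_gt0 (max1 k).
  apply: HQ hc r7 _; first lia.
  by move=> k'; rewrite jE.
Qed.

(** The candidates left in the middle of a scan, when the first [i] rows have been compared with the
    answer [x]. *)
Definition sweep (m : nat) (s : seq (bits m)) (B : {set bits m}) j x i : {set bits m} :=
  [set b in B | (index b s < i) ==> (b j == x)].

Lemma sweepS (m : nat) (a : bits m) (s : seq (bits m)) (B : {set bits m}) j x i :
  uniq s -> {subset B <= s} -> i < size s ->
  sweep s B j x i.+1 =
    if nth a s i j == x then sweep s B j x i else sweep s B j x i :\ nth a s i.
Proof.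
move=> us Bs lti.
have step b : b \in B -> (index b s < i.+1) = (index b s < i) || (b == nth a s i).
  move=> /Bs bs; rewrite ltnS leq_eqVlt orbC; congr (_ || _).
  apply/eqP/eqP=> [<-|->]; by rewrite ?nth_index ?index_uniq.
case: ifPn => nx; apply/setP=> b; rewrite !inE.
  case bB: (b \in B) => //=; rewrite step //.
  by case: eqVneq => [->|]; rewrite ?nx ?implybT ?orbF.
case bB: (b \in B) => /=; last by rewrite andbF.
rewrite step //; case: eqVneq => [->|]; rewrite ?orbT ?orbF //=.
exact: negbTE.
Qed.

(** The cost is amortised: each candidate holds a credit of [18 * m + 60], which pays for its
    [row_loop] when it is discarded. Over successive scans these terms telescope. *)
Lemma wp_scan (W m : nat) (a : bits m) (s : seq (bits m)) (B : {set bits m}) (j : 'I_m)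
    (Q : nat -> seq 'I_m -> state -> Prop) st :
  m < W -> 1 < W -> size s < W -> size s * m < W -> uniq s -> {subset B <= s} ->
  holds_candidates a s B st -> reg st 7 = j -> reg st 8 = a j ->
  (forall t st', t + #|restrict B j (a j)| * (18 * m + 60)
                   <= 60 * size s + 10 + #|B| * (18 * m + 60) ->
     holds_candidates a s (restrict B j (a j)) st' -> Q t [::] st') ->
  wp W a scan Q st.
Proof.
move=> mW W1 nW nmW us Bs hcB r7 r8 HQ.
have BW : #|B| < W.
  rewrite (leq_ltn_trans _ nW) // -(card_uniqP us); exact/subset_leq_card/subsetP.
apply: wp_seq; apply: wp_assign => /=; first slia.
apply: wp_seq; apply: wp_assign => /=; first slia.
pose I (T : nat) (js : seq 'I_m) (st' : state) :=
  [/\ js = [::], reg st' 2 <= size s, reg st' 3 = reg st' 2 * m,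
    T + #|sweep s B j (a j) (reg st' 2)| * (18 * m + 60)
      <= 60 * reg st' 2 + #|B| * (18 * m + 60) &
    [/\ reg st' 7 = j, reg st' 8 = a j &
      holds_candidates a s (sweep s B j (a j) (reg st' 2)) st']].
apply: (wp_while (I := I) (mu := fun st => size s - reg st 2)).
- have B0 : sweep s B j (a j) 0 = B by apply/setP=> b; rewrite inE andbT.
  split=> //=; rewrite B0 //; split=> //.
  by apply: holds_candidates_frame hcB _ _ => //= x; rewrite !inE => /or3P[] /eqP->.
- move=> T js st1 [-> le2 r3 TT [r7' r8' hc]] /=; rewrite (hc_n hc) => lt2.
  have {}lt2 : reg st1 2 < size s by slia.
  set b := nth a s (reg st1 2).
  have leM : (reg st1 2).+1 * m <= size s * m by rewrite leq_mul2r lt2 orbT.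
  rewrite mulSn in leM.
  have bE : arr st1 0 (reg st1 3 + reg st1 7) = b j.
    by rewrite r3 r7' (hc_input hc).
  have SE := sweepS a j (a j) us Bs lt2; rewrite -/b in SE.
  have deadE := hc_dead hc lt2; rewrite -/b in deadE.
  (* Two branches discard nothing, for a row already marked and for a row agreeing with the answer;
     both end in this way. *)
  have keep T' st2 : sweep s B j (a j) (reg st1 2).+1 = sweep s B j (a j) (reg st1 2) ->
      st2 = st1 -> T' <= T + 40 ->
      wp W a next_row (fun t js' st3 => I (T' + t) js' st3 /\
        size s - reg st3 2 < size s - reg st1 2) st2.
    move=> eqS -> T'T.
    apply: wp_seq; apply: wp_assign => /=; first slia.
    apply: wp_assign => /=; rewrite (hc_m hc) ?r3; first slia.
    split; last slia.
    split=> //=; rewrite ?addn1 ?eqS //; try slia; split=> //.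
    by apply: holds_candidates_frame hc _ _ => //= x; rewrite !inE => /or3P[] /eqP->.
  apply: wp_seq; apply: wp_if; rewrite /= deadE.
  case: ifPn => bS.
    apply: wp_skip; apply: wp_weaken (keep (T + 20) _ _ _ _) _ => //; try slia.
      rewrite SE; case: ifP => // _; apply/setP=> b'; rewrite in_setD1.
      by case: eqVneq => // ->; rewrite (negbTE bS).
    move=> t js' st' /= [[-> ? ? ? ?] ?]; split=> //; split=> //; slia.
  rewrite negbK in bS.
  apply: wp_if; rewrite /= bE r8'.
  have [eqb|neb] := eqVneq (b j) (a j).
    rewrite eqb subnn /=.
    apply: wp_skip; apply: wp_weaken (keep (T + 40) _ _ _ _) _ => //; try slia.
      by rewrite SE eqb eqxx.
    move=> t js' st' /= [[-> ? ? ? ?] ?]; split=> //; split=> //; slia.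
  have -> : b j - a j + (a j - b j) != 0 by case: (b j) (a j) neb => [] [].
  rewrite (negbTE neb) in SE.
  have cardS := cardsD1 b (sweep s B j (a j) (reg st1 2)); rewrite bS -SE in cardS.
  rewrite cardS in TT.
  have SB : #|sweep s B j (a j) (reg st1 2)| <= #|B|.
    by apply/subset_leq_card/subsetP=> b'; rewrite inE => /andP[].
  apply: wp_seq; apply: wp_store => //=.
  apply: wp_seq; apply: wp_assign => /=; rewrite (hc_card hc); first slia.
  have rE (k : 'I_m) : arr st1 0 (reg st1 3 + k) = b k by rewrite r3 (hc_input hc).
  apply: (@wp_row_loop _ _ _ Sub subn) => //=.
  + exact: hc_m hc.
  + move=> k; rewrite (hc_count hc).
    have := subset_leq_card (restrict_sub (sweep s B j (a j) (reg st1 2)) k true).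
    slia.
  move=> t1 st2 t1E g1 h1 c1; rewrite /= in c1.
  apply: wp_seq; apply: wp_assign => /=; rewrite !g1 //=; first slia.
  apply: wp_assign => /=; rewrite !g1 //= (hc_m hc) r3; first slia.
  split; last slia.
  split=> //=; rewrite ?addn1 ?g1 //=; try slia.
  split=> //=; rewrite ?g1 //=.
  split=> //=; rewrite ?g1 //=.
  + exact: hc_m hc.
  + exact: hc_n hc.
  + slia.
  + by move=> i k lti; rewrite h1 //= (hc_input hc).
  + by move=> k; rewrite c1 rE (hc_count hc) SE card_restrictD1.
  + move=> i lti; rewrite h1 //= SE in_setD1 /b nth_uniq // -(hc_dead hc lti).
    by case: (i == reg st1 2).
- move=> T js st1 [-> le2 r3 TT [r7' r8' hc]] /=; rewrite (hc_n hc) => ge2.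
  have E : sweep s B j (a j) (reg st1 2) = restrict B j (a j).
    apply/setP=> b; rewrite !inE; case bB: (b \in B) => //=.
    by rewrite (leq_trans _ (_ : size s <= _)) ?index_mem ?Bs //; slia.
  rewrite E in TT hc; apply: HQ => //; slia.
Qed.

Lemma exec_ammrs_prog (m : nat) (A : {set bits m}) (s : seq (bits m)) (a : bits m) :
  0 < m -> uniq s -> s =i A -> a \in A ->
  wp (500 * (m * #|A|)) a ammrs_prog
    (fun t js st => [/\ t <= 500 * (m * #|A|), ammrs a A js [set a]
                      & reg st 0 = index a s])
    (input_state s).
Proof.
move=> m0 us sA aA.
have cardA : #|A| = size s by rewrite -(card_uniqP us); exact/esym/eq_card.
have n0 : 0 < #|A| by apply/card_gt0P; exists a.
rewrite cardA in n0 *.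
set n := size s in n0 *.
have mn : m <= m * n by rewrite leq_pmulr.
have nm : n <= m * n by rewrite leq_pmull.
set W := 500 * (m * n).
have mW : m < W by slia.
have nW : n < W by slia.
have nmW : n * m < W by rewrite mulnC; slia.
apply: wp_seq; apply: (wp_init (A := A)) => // t1 st1 t1E hc1.
apply: wp_seq.
pose I (T : nat) (js : seq 'I_m) (st : state) := exists B,
  [/\ holds_candidates a s B st, ammrs a A js B, a \in B &
   [/\ B \subset A, uniq js, forall b k, b \in B -> k \in js -> b k = a k,
     size js + #|B| <= n &
     T + #|B| * (18 * m + 60) <= size js * (50 * m + 60 * n + 50) + n * (18 * m + 60)]].
apply: (wp_while (I := I) (mu := fun st => reg st 5)).
- exists A; split=> //; first by constructor.
  by split=> //; rewrite cardA //= /n; slia.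
- move=> T js st [B [hc run aB [BA ujs agree sz TT]]] /=.
  rewrite (hc_card hc) => B2.
  have {}B2 : 2 <= #|B| by slia.
  apply: wp_seq; apply: (wp_argmax _ _ B2 hc) => //; first slia.
  move=> t2 st2 j t2E hc2 r7 jmax.
  apply: wp_seq; apply: (wp_query (j := j)) => //=; first by case: (a j); slia.
  have step : ammrs_step a B j (restrict B j (a j)) by [].
  have [k k0] := minsplit_gt0 B2.
  have jgt0 : 0 < minsplit B j := leq_trans k0 (jmax k).
  have cardB := card_restrict B j (a j).
  have lost : 0 < #|restrict B j (~~ a j)| := leq_trans jgt0 (minsplit_le B j (~~ a j)).
  apply: (wp_scan (s := s) (B := B) (j := j)) => //=; first by slia.
  + by move=> b /(subsetP BA); rewrite sA.
  + by apply: holds_candidates_frame hc2 _ _ => //= x; rewrite !inE => /or3P[] /eqP->.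
  move=> t3 st3 t3E hc3; rewrite (hc_card hc3) cats1; split; last slia.
  exists (restrict B j (a j)); split=> //.
  + exact: ammrs_rcons run step.
  + by rewrite in_restrict aB eqxx.
  split.
  + exact: subset_trans (restrict_sub _ _ _) BA.
  (* Had [j] been asked before, all of [B] would agree with [a] at [j], and the round would discard
     nothing. *)
  + rewrite rcons_uniq ujs andbT; apply: contraTN lost => jjs.
    rewrite -leqNgt leqn0 cards_eq0; apply/eqP/setP=> b.
    rewrite in_restrict in_set0; case bB: (b \in B) => //=; rewrite (agree b j bB jjs).
    by case: (a j).
  + move=> b k'; rewrite in_restrict mem_rcons in_cons => /andP[bB /eqP bj].
    by case/orP=> [/eqP-> //|]; exact: agree.
  + rewrite size_rcons; slia.
  + rewrite size_rcons -/n in t3E *; slia.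
- move=> T js st [B [hc run aB [BA ujs agree sz TT]]] /=.
  rewrite (hc_card hc) => B1.
  have {B1}BE : B = [set a].
    have B0 : 0 < #|B| by apply/card_gt0P; exists a.
    have /cards1P[b Bb] : #|B| == 1 by slia.
    by move: aB; rewrite Bb inE => /eqP->.
  have szm : size js <= m by rewrite -(card_uniqP ujs) -[X in _ <= X]card_ord max_card.
  have ltia : index a s < n by rewrite index_mem sA.
  apply: wp_seq; apply: wp_assign => /=; first slia.
  (* Only the row of [a] is still unmarked, so the search cannot pass it and cannot stop before
     it. *)
  pose J (T : nat) (js : seq 'I_m) (st' : state) :=
    [/\ js = [::], reg st' 2 <= index a s, T <= 10 * reg st' 2 &
        arr st' = arr st].
  apply: wp_seq; apply: (wp_while (I := J) (mu := fun st => n - reg st 2)).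
  + by split.
  + move=> T1 js1 st2 [-> le2 T1E arrE] /= d.
    have lt2 : reg st2 2 < index a s.
      rewrite ltn_neqAle le2 andbT; apply: contraNneq d => ->.
      by rewrite arrE (hc_dead hc) // nth_index ?sA // BE inE.
    apply: wp_assign => /=; first slia.
    split; last slia.
    by split=> //=; slia.
  + move=> T1 js1 st2 [-> le2 T1E arrE] /= d.
    have r2 : reg st2 2 = index a s.
      have lt2 : reg st2 2 < n by slia.
      have := hc_dead hc lt2; rewrite -arrE d eqxx BE inE => /esym/eqP <-.
      by rewrite index_uniq.
    apply: wp_assign => /=; first slia.
    rewrite cats0 -BE; split=> //.
    (* A round costs a multiple of [m] plus a multiple of [n]. The first is summed over at most [n]
       rounds, the second over at most [m], so both totals are O([m * n]). *)
    have h1 : size js * m <= n * m by rewrite leq_mul2r; slia.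
    have h2 : size js * n <= m * n by rewrite leq_mul2r szm orbT.
    rewrite -/n in t1E; nia.
Qed.

(** * Progress of the algorithm in one round *)

Lemma minsplit_MAMI (m : nat) (B : {set bits m}) j : minsplit B j <= MAMI B.
Proof. exact: leq_bigmax. Qed.

Lemma MAMI_gt0 (m : nat) (B : {set bits m}) : 2 <= #|B| -> 0 < MAMI B.
Proof. by move=> /minsplit_gt0[j j0]; apply: leq_trans j0 (minsplit_MAMI B j). Qed.

Lemma ammrs_step_exists (m : nat) (a : bits m) (B : {set bits m}) :
  2 <= #|B| -> exists j B', ammrs_step a B j B'.
Proof.
move=> B2; have [k _] := minsplit_gt0 B2.
have [j _ jmax] := @arg_maxnP _ k xpredT (minsplit B) isT.
by exists j, (restrict B j (a j)); split=> // i; apply: jmax.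
Qed.

(** Whatever the answer, the part thrown away has at least [minsplit B j] elements, and this is
    [MAMI B] by the choice of [j]. *)
Lemma ammrs_step_card (m : nat) (a : bits m) (B B' : {set bits m}) j :
  ammrs_step a B j B' -> #|B'| + MAMI B <= #|B|.
Proof.
move=> [B2 jmax ->]; rewrite -(card_restrict B j (a j)) leq_add2l.
rewrite (leq_trans _ (minsplit_le B j (~~ a j))) //.
by apply/bigmax_leqP=> k _.
Qed.

Lemma ammrs_step_mem (m : nat) (a : bits m) (B B' : {set bits m}) j :
  ammrs_step a B j B' -> (a \in B') = (a \in B).
Proof. by move=> [_ _ ->]; rewrite in_restrict eqxx andbT. Qed.

Lemma ammrs_step_sub (m : nat) (a : bits m) (B B' : {set bits m}) j :
  ammrs_step a B j B' -> B' \subset B.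
Proof. by move=> [_ _ ->]; apply: restrict_sub. Qed.

Lemma ammrs_mem (m : nat) (a : bits m) (A B : {set bits m}) js :
  ammrs a A js B -> (a \in B) = (a \in A).
Proof. by elim=> // C j C' ks C'' /ammrs_step_mem st _ ->. Qed.

(** Runs may be unfinished. With a bound on the length of every run, this shows that continuing one
    as long as possible identifies [a]. *)
Lemma ammrs_status (m : nat) (a : bits m) (A B : {set bits m}) js :
  a \in A -> ammrs a A js B -> B = [set a] \/ exists j B', ammrs_step a B j B'.
Proof.
move=> aA /ammrs_mem; rewrite aA => aB.
have [B2|B1] := leqP 2 #|B|; [by right; apply: ammrs_step_exists|left].
have /cards1P[b Bb] : #|B| == 1.
  by rewrite eqn_leq -ltnS B1; apply/card_gt0P; exists a.
by move: aB; rewrite Bb inE => /eqP->.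
Qed.

(** * Decision trees and specifying sets against [MAMI] *)

Lemma dtree_for_restrict (m : nat) (A : {set bits m}) j t0 t1 x :
  dtree_for A (Node j t0 t1) -> dtree_for (restrict A j x) (if x then t1 else t0).
Proof.
move=> At a; rewrite in_restrict => /andP[/At /= tE /eqP aj].
by move: tE; rewrite aj; case: x {aj}.
Qed.

Lemma dtree_for_leaf (m : nat) (A : {set bits m}) b : dtree_for A (Leaf b) -> #|A| <= 1.
Proof. by move=> Ab; apply/card_le1_eqP=> x y /Ab <- /Ab <-. Qed.

Lemma card_dtree (m : nat) (A : {set bits m}) t : dtree_for A t -> #|A| <= 2 ^ depth t.
Proof.
elim: t A => [b|j t0 IH0 t1 IH1] A; first by move=> /dtree_for_leaf.
move=> At /=; rewrite -(card_restrict A j true) expnS mul2n -addnn leq_add //.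
  apply: leq_trans (IH1 _ (dtree_for_restrict (x := true) At)) _.
  by rewrite leq_pexp2l // leq_maxr.
apply: leq_trans (IH0 _ (dtree_for_restrict (x := false) At)) _.
by rewrite leq_pexp2l // leq_maxl.
Qed.

(* Answering every query of the tree with the majority value on [B] discards at
   most [MAMI B] elements per query, and a leaf is left with one. *)
Lemma card_dtree_MAMI (m : nat) (B C : {set bits m}) t :
  C \subset B -> dtree_for C t -> #|C| <= 1 + MAMI B * depth t.
Proof.
elim: t C => [b|j t0 IH0 t1 IH1] C CB; first by move=> /dtree_for_leaf; rewrite muln0.
have subB x : restrict C j x \subset B := subset_trans (restrict_sub C j x) CB.
have cardr x : #|restrict C j x| <= #|restrict B j x|.
  apply/subset_leq_card/subsetP=> b; rewrite !in_restrict.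
  by move=> /andP[/(subsetP CB) -> ->].
move=> Ct /=; rewrite mulnS addnCA.
(* [x] is the majority value on the fixed set [B]; only [C] shrinks along the path. *)
have [x ltx] : exists x, #|restrict B j (~~ x)| <= MAMI B.
  have := minsplit_MAMI B j; rewrite /minsplit /minn.
  by case: ifP => _; [exists true|exists false].
rewrite -(card_restrict C j x) addnC; apply: leq_add; first exact: leq_trans (cardr _) ltx.
case: x {ltx} => /=.
  apply: leq_trans (IH1 _ (subB _) (dtree_for_restrict (x := true) Ct)) _.
  by rewrite leq_add2l leq_mul2l leq_maxr orbT.
apply: leq_trans (IH0 _ (subB _) (dtree_for_restrict (x := false) Ct)) _.
by rewrite leq_add2l leq_mul2l leq_maxl orbT.
Qed.

Lemma OPT_dtree (m : nat) (A : {set bits m}) : exists2 t, dtree_for A t & depth t = OPT A.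
Proof. by rewrite /OPT; case: ex_minnP => d /asboolP. Qed.

Lemma card_OPT (m : nat) (A : {set bits m}) : #|A| <= 2 ^ OPT A.
Proof. by have [t /card_dtree le <-] := OPT_dtree A. Qed.

Lemma card_MAMI_OPT (m : nat) (A B : {set bits m}) :
  B \subset A -> #|B| <= 1 + MAMI B * OPT A.
Proof.
move=> BA; have [t At <-] := OPT_dtree A.
by apply: (card_dtree_MAMI (subxx B)) => b /(subsetP BA) /At.
Qed.

(* A set specifying the majority vector [h] of [B] separates all but one
   element of [B] from [h], and each of its indices only a minority. *)
Lemma card_MAMI_ETD (m : nat) (A B : {set bits m}) :
  B \subset A -> #|B| <= 1 + MAMI B * ETD A.
Proof.
move=> BA.
pose h : bits m := [ffun j => #|restrict B j false| <= #|restrict B j true|].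
have minor j : #|restrict B j (~~ h j)| <= MAMI B.
  rewrite (leq_trans _ (minsplit_MAMI B j)) // /minsplit ffunE /minn.
  by case: ltngtP => //= ->.
have spec0 : specifying A h [set: 'I_m].
  apply/card_le1_eqP=> b c; rewrite !inE => /andP[_ /forall_inP bh] /andP[_ /forall_inP ch].
  by apply/ffunP=> j; rewrite (eqP (bh j _)) ?(eqP (ch j _)) ?inE.
have : #|[arg min_(S < [set: 'I_m] | specifying A h S) #|S| ]| <= ETD A.
  exact: (bigmax_sup h).
case: arg_minnP => // S specS _ SE.
apply: (@leq_trans (1 + \sum_(j in S) #|restrict B j (~~ h j)|)); last first.
  rewrite leq_add2l (leq_trans (leq_sum _ (fun j _ => minor j))) //.
  by rewrite sum_nat_const mulnC leq_mul2l SE orbT.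
apply: (@leq_trans (#|[set a in A | [forall j in S, a j == h j]]|
                    + #|\bigcup_(j in S) restrict B j (~~ h j)|)); last first.
  rewrite leq_add //; elim/big_rec2: _ => [|j x y _ le]; first by rewrite cards0.
  by rewrite (leq_trans (leq_card_setU _ _)) // leq_add2l.
rewrite (leq_trans _ (leq_card_setU _ _)) //; apply/subset_leq_card/subsetP=> b bB.
rewrite !inE (subsetP BA _ bB) /=.
case: (boolP [forall j in S, b j == h j]) => //= /forall_inPn[j jS bj].
apply/bigcupP; exists j => //; rewrite in_restrict bB.
by move: bj; case: (b j) (h j) => [] [].
Qed.

(** * Elementary bounds on [DEN] *)

Import Order.TTheory GRing.Theory Num.Theory.
Local Open Scope ring_scope.

Lemma DEN_ge0 (R : realType) (m : nat) (A : {set bits m}) : 0 <= DEN R A.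
Proof. exact: bigmax_ge_id. Qed.

Lemma card_le_DEN (R : realType) (m : nat) (A B : {set bits m}) :
  B \subset A -> (2 <= #|B|)%N -> (#|B|%:R - 1 : R) <= DEN R A * (MAMI B)%:R.
Proof.
move=> BA B2; rewrite -ler_pdivrMr ?ltr0n ?MAMI_gt0 //.
pose F (C : {set bits m}) : R := if (1 < #|C|)%N then (#|C|%:R - 1) / (MAMI C)%:R else 0.
have -> : (#|B|%:R - 1) / (MAMI B)%:R = F B by rewrite /F B2.
exact: (@le_bigmax_cond _ _ _ 0 B (fun C => C \subset A) F BA).
Qed.

(** The common route to [DEN <= OPT] and [DEN <= ETD]. *)
Lemma DEN_le_nat (R : realType) (m : nat) (A : {set bits m}) (c : nat) :
  (forall B : {set bits m}, B \subset A -> (#|B| <= 1 + MAMI B * c)%N) ->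
  DEN R A <= c%:R.
Proof.
move=> H; apply: bigmax_le => // B BA; case: ifPn => // B2.
rewrite ler_pdivrMr ?ltr0n ?MAMI_gt0 // lerBlDl mulrC -natrM -(natrD _ 1 _) ler_nat.
exact: H.
Qed.

Lemma DEN_ge2 (R : realType) (m : nat) (A : {set bits m}) :
  (3 <= #|A|)%N -> 2 <= DEN R A.
Proof.
move=> /card_gt2P[b [c [d [[bA cA dA] [bc cd db]]]]].
have B3 : #|[set b; c; d]| = 3.
  by rewrite setUC cardsU1 cards2 !inE bc [d == c]eq_sym (negbTE cd) (negbTE db).
have BA : [set b; c; d] \subset A.
  by apply/subsetP=> e; rewrite !inE => /orP[/orP[]|] /eqP->.
have M1 : (MAMI [set b; c; d] <= 1)%N.
  apply/bigmax_leqP=> j _; have := card_restrict [set b; c; d] j true.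
  by rewrite B3 /minsplit /=; lia.
have := card_le_DEN R BA; rewrite B3 => /(_ isT) H.
have : DEN R A * (MAMI [set b; c; d])%:R <= DEN R A * 1.
  by rewrite ler_wpM2l ?DEN_ge0 // lern1.
lra.
Qed.

(** * Numerical estimates for logarithm and exponential *)

Lemma lnB_ge (R : realType) (x y : R) : 0 < x -> 0 < y -> 1 - y / x <= ln x - ln y.
Proof.
move=> x0 y0; have yx0 : 0 < y / x by rewrite divr_gt0.
have : ln (1 + (y / x - 1)) <= y / x - 1 by apply: le_ln1Dx; lra.
have -> : 1 + (y / x - 1) = y / x by ring.
by rewrite ln_div ?posrE //; lra.
Qed.

(* From [1 / 8 <= ln (8 / 7)]. *)
Lemma ln_ge_eighths (R : realType) (x : R) k : (8 / 7) ^+ k <= x -> k%:R / 8 <= ln x.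
Proof.
have p0 : 0 < (8 / 7 : R) by lra.
have := lnB_ge p0 (@ltr01 R); rewrite ln1 subr0 => l1 kx.
apply: (@le_trans _ _ (ln ((8 / 7) ^+ k))).
  rewrite lnXn // -[ln _ *+ k]mulr_natl ler_wpM2l //; lra.
by rewrite ler_ln ?posrE ?exprn_gt0 // (lt_le_trans _ kx) ?exprn_gt0.
Qed.

(** The 4th, 8th and 12th powers of [8 / 7] are about 1.71, 2.91 and 4.96, hence below 2, 3 and
    5. *)
Lemma ln2_ge (R : realType) : 1 / 2 <= ln (2 : R).
Proof. by apply: le_trans (ln_ge_eighths (k := 4) _); lra. Qed.

Lemma ln3_ge (R : realType) : 1 <= ln (3 : R).
Proof. by apply: le_trans (ln_ge_eighths (k := 8) _); lra. Qed.

Lemma ln5_ge (R : realType) : 3 / 2 <= ln (5 : R).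
Proof. by apply: le_trans (ln_ge_eighths (k := 12) _); lra. Qed.

(** The left side is the larger one for small positive [u], so [u] has to stay away from 0. The
    proof bounds [expR (- u / 8)] below by [1 - u / 8] and squares three times, keeping the
    intermediate bounds quadratic. *)
Lemma expRN_ge (R : realType) (u : R) :
  1 / 3 <= u <= 1 / 2 -> 1 - 7 / 8 * u <= expR (- u).
Proof.
move=> /andP[u1 u2].
have -> : - u = 8%:R * (- u / 8) by lra.
rewrite expRM_natl.
apply: (@le_trans _ _ ((1 - u / 8) ^+ 8)); last first.
  by rewrite lerXn2r ?nnegrE ?expR_ge0 //; [lra|have := @expR_ge1Dx R (- u / 8); lra].
have uu0 : 0 <= u * u by nra.
have uuu : 0 <= u * u * (1 - 2 * u) by rewrite mulr_ge0 //; lra.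
have u4 : 0 <= u * u * (u * u) by rewrite mulr_ge0.
have u3 : 0 <= u * (3 * u - 1) by rewrite mulr_ge0 //; lra.
have s1 : 1 - u / 4 + u * u / 64 <= (1 - u / 8) ^+ 2 by rewrite expr2; lra.
(* The exact quadratic coefficient is [24 / 256]; since [u <= 1 / 2], giving up [1 / 256] pays for
   the cubic term [- u ^+ 3 / 128]. *)
have s2 : 1 - u / 2 + 23 / 256 * (u * u) <= ((1 - u / 8) ^+ 2) ^+ 2.
  apply: (@le_trans _ _ ((1 - u / 4 + u * u / 64) ^+ 2)).
    rewrite expr2; lra.
  rewrite lerXn2r ?nnegrE //; lra.
have -> : (1 - u / 8) ^+ 8 = (((1 - u / 8) ^+ 2) ^+ 2) ^+ 2 by rewrite -!exprM.
apply: (@le_trans _ _ ((1 - u / 2 + 23 / 256 * (u * u)) ^+ 2)).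
  rewrite expr2; lra.
rewrite lerXn2r ?nnegrE //; lra.
Qed.

(** * Potentials and the number of queries *)

Definition split_potential (R : realType) (D : R) (F : nat -> R) : Prop :=
  (forall x, 0 <= F x) /\
  (forall x x' M : nat, (0 < M)%N -> (x' + M <= x)%N -> x%:R <= D * M%:R ->
     F x' + 1 <= F x).

(** In each round [x], [x'] and [M] of [split_potential] are the old and new cardinal minus one and
    the [MAMI] of the old set. The start [C] is separate from [A] so that [DEN R A] stays fixed in
    the induction. *)
Lemma ammrs_potential (R : realType) (m : nat) (a : bits m) (A B C : {set bits m})
    (js : seq 'I_m) (F : nat -> R) :
  split_potential (DEN R A) F -> C \subset A -> a \in C -> ammrs a C js B ->
  (size js)%:R <= F #|C|.-1.
Proof.
move=> [F0 FS] CA aC run; elim: run CA aC => [C' _ _|C' j C'' ks B' st _ IH CA aC].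
  exact: F0.
have {}IH := IH (subset_trans (ammrs_step_sub st) CA).
rewrite (ammrs_step_mem st) in IH; have {}IH := IH aC.
have C2 : (2 <= #|C'|)%N by case: st.
have C''0 : (0 < #|C''|)%N by apply/card_gt0P; exists a; rewrite (ammrs_step_mem st).
have le := ammrs_step_card st.
rewrite /= -natr1; apply: le_trans (FS _ #|C''|.-1 _ (MAMI_gt0 C2) _ _).
- by rewrite lerD2r.
- by move: le C''0 C2; case: #|C'| #|C''| => [|x] [|y].
- by rewrite -subn1 natrB ?(ltnW C2) //; apply: card_le_DEN.
Qed.

(** Every round discards an element; this suffices for sets of at most two elements. *)
Lemma id_potential (R : realType) (D : R) : split_potential D (fun x => x%:R).
Proof.
by split=> // x x' M M0 le _; rewrite natr1 ler_nat (leq_trans _ le) // -addn1 leq_add2l.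
Qed.

(* Beyond [D] the potential continues the identity with matching slope, so it is
   concave and drops by at least its slope [D / x] times the decrease [x / D]. *)
Lemma large_potential (R : realType) (D : R) : 3 <= D ->
  split_potential D
    (fun x => if x%:R <= D then x%:R else D * (ln x%:R - ln D + 1)).
Proof.
move=> D3; have D0 : 0 < D by lra.
split=> [x|x x' M M0 le xDM].
  case: ifPn => [_|]; first exact: ler0n.
  rewrite -ltNge => ltDx; rewrite mulr_ge0 ?(ltW D0) //.
  have : ln D <= ln x%:R by rewrite ler_ln ?posrE ?(ltW ltDx) ?(lt_trans D0 ltDx).
  lra.
have M1 : 1 <= M%:R :> R by rewrite ler1n.
have leR : x'%:R + M%:R <= x%:R :> R by rewrite -natrD ler_nat.
have x'0 : 0 <= x'%:R :> R := ler0n _ _.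
case: (leP x%:R D) => [xD|Dx]; first by rewrite ifT; lra.
have x0 : 0 < x%:R :> R := lt_trans D0 Dx.
have lnD := lnB_ge x0 D0.
case: (leP x'%:R D) => [x'D|Dx'].
  have vx : D / x%:R * x%:R = D by rewrite divfK // gt_eqF.
  set v := D / x%:R in lnD vx.
  have v0 : 0 < v by rewrite divr_gt0.
  have v1 : v < 1 by rewrite ltr_pdivrMr ?mul1r.
  have vM : 1 <= v * M%:R.
    by rewrite -(ler_pM2r x0) mul1r mulrAC vx.
  (* The round crosses [D]. The products in [h1] and [h2] add up to [D * (2 - v) - x' - v * M],
     where [v * M >= 1]; and [D * (2 - v)] is a lower bound for the potential at [x] by [h3]. *)
  have h1 : 0 <= (1 - v) * (D - x'%:R) by rewrite mulr_ge0; lra.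
  have h2 : 0 <= v * (x%:R - M%:R - x'%:R) by rewrite mulr_ge0; lra.
  have h3 : 0 <= D * (ln x%:R - ln D - (1 - v)) by rewrite mulr_ge0; lra.
  lra.
have x'gt0 : 0 < x'%:R :> R := lt_trans D0 Dx'.
have lnx := lnB_ge x0 x'gt0.
have h : 1 <= D * (ln x%:R - ln x'%:R).
  apply: (@le_trans _ _ (D * (1 - x'%:R / x%:R))); last by rewrite ler_pM2l.
  rewrite -(ler_pM2r x0) mul1r -mulrA mulrBl divfK ?gt_eqF // mul1r.
  by apply: le_trans xDM _; rewrite ler_pM2l //; lra.
lra.
Qed.

(** Up to 6, the most rounds possible when each takes more than a third off [x], as [D < 3]
    enforces. *)
Definition small_steps (x : nat) : nat := nth 3 [:: 0; 1; 2; 2; 3; 3; 3]%N x.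

(** With [D >= 2], the entries 1, 2 and 3 first occur at [x] = 1, 2 and 4 and are covered there by
    the estimates for [ln 2], [ln 3] and [ln 5]. *)
Lemma small_potential_le (R : realType) (D : R) x :
  2 <= D -> (x < 7)%N -> (small_steps x)%:R <= D * ln x.+1%:R.
Proof.
move=> D2 x7.
have l2 := ln2_ge R; have l3 := ln3_ge R; have l5 := ln5_ge R.
have mono y z : (0 < y)%N -> (y <= z)%N -> ln (y%:R : R) <= ln z%:R.
  by move=> y0 yz; rewrite ler_ln ?posrE ?ltr0n ?ler_nat ?(leq_trans y0).
have bound c k y : (0 < y)%N -> (y <= x.+1)%N -> 0 <= c -> c <= ln (y%:R : R) ->
    k <= 2 * c -> k <= D * ln x.+1%:R.
  move=> y0 yx c0 cy kc; apply: le_trans kc _; apply: ler_pM => //.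
  exact: le_trans cy (mono _ _ y0 yx).
case: x x7 bound => [|[|[|x]]] x7 bound.
- by rewrite ln1 mulr0.
- by apply: (bound (1 / 2) _ 2); rewrite // /small_steps /=; lra.
- by apply: (bound 1 _ 3); rewrite // /small_steps /=; lra.
case: x x7 bound => [|x] x7 bound.
  by apply: (bound 1 _ 3); rewrite // /small_steps /=; lra.
apply: (bound (3 / 2) _ 5) => //; try lra.
by move: x7; rewrite /small_steps; do 4?[case: x bound => [|x] bound] => //= _; lra.
Qed.

Lemma small_steps_split (x x' M : nat) :
  (x < 7)%N -> (x' + M <= x)%N -> (x < 3 * M)%N -> (small_steps x' < small_steps x)%N.
Proof.
by move: x x' => [|[|[|[|[|[|[|x]]]]]]] [|[|[|[|[|[|[|x']]]]]]] //=; lia.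
Qed.

Lemma small_potential (R : realType) (D : R) : 2 <= D < 3 ->
  split_potential D
    (fun x => if (x < 7)%N then (small_steps x)%:R else D * ln x.+1%:R).
Proof.
move=> /andP[D2 D3]; have D0 : 0 < D by lra.
have le_log x : (if (x < 7)%N then (small_steps x)%:R else D * ln x.+1%:R)
    <= D * ln x.+1%:R.
  by case: ifP => // x7; apply: small_potential_le.
split=> [x|x x' M M0 le xDM].
  by case: ifPn => _; rewrite ?ler0n // mulr_ge0 ?(ltW D0) // ln_ge0 // ler1n.
case: (ltnP x 7) => x7.
  rewrite (leq_ltn_trans (leq_trans (leq_addr M x') le) x7).
  rewrite natr1 ler_nat; apply: small_steps_split le _ => //.
  rewrite -(ltr_nat R) natrM; apply: le_lt_trans xDM _.
  by rewrite ltr_pM2r ?ltr0n.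
(* The logarithm dominates the table, so it may stand for the potential at [x'] on either side of
   7. *)
apply: le_trans (_ : D * ln x'.+1%:R + 1 <= _); first by rewrite lerD2r.
have x7R : 7 <= x%:R :> R by rewrite ler_nat.
have leR : x'%:R + M%:R <= x%:R :> R by rewrite -natrD ler_nat.
have x'0 : 0 <= x'%:R :> R := ler0n _ _.
rewrite -(natr1 x) -(natr1 x').
have uD : D^-1 * D = 1 by rewrite mulVf // gt_eqF.
set u := D^-1 in uD; have u0 : 0 < u by rewrite invr_gt0.
have u13 : 1 / 3 <= u <= 1 / 2.
  by apply/andP; split; rewrite -(ler_pM2r D0) uD; lra.
have uM : x%:R * u <= M%:R by rewrite -(ler_pM2r D0) -mulrA uD mulr1 mulrC.
have ux : 0 <= u * (x%:R - 7) by rewrite mulr_ge0; lra.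
(* From [x >= 7] follows [x >= 7 / 8 * (x + 1)], which absorbs the shift by one; this fixes the
   factor in [expRN_ge]. *)
have ratio : x'%:R + 1 <= (x%:R + 1) * (1 - 7 / 8 * u) by lra.
have {}ratio : x'%:R + 1 <= (x%:R + 1) * expR (- u).
  apply: le_trans ratio _; rewrite ler_pM2l ?expRN_ge //; lra.
have : ln (x'%:R + 1) <= ln ((x%:R + 1) * expR (- u)).
  rewrite ler_ln ?posrE //; first lra.
  by rewrite mulr_gt0 ?expR_gt0 //; lra.
rewrite lnM ?posrE ?expR_gt0 ?expRK //; last lra.
move=> lnx; have : D * ln (x'%:R + 1) <= D * (ln (x%:R + 1) - u) by rewrite ler_pM2l.
lra.
Qed.

Lemma potential_exists (R : realType) (D : R) : 2 <= D ->
  exists2 F, split_potential D F &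
    forall x, (2 <= x)%N -> F x <= D * ln x.+1%:R.
Proof.
move=> D2; have l3 := ln3_ge R; have [D3|D3] := ltP D 3.
  exists (fun x => if (x < 7)%N then (small_steps x)%:R else D * ln x.+1%:R).
    by apply: small_potential; rewrite D2.
  by move=> x _; case: ifP => // x7; apply: small_potential_le.
eexists; first exact: large_potential D3.
move=> x x2 /=.
have x0 : 0 < x%:R :> R by rewrite ltr0n (leq_trans _ x2).
have lnS : ln x%:R <= ln x.+1%:R :> R.
  by rewrite ler_ln ?posrE ?ltr0n ?ler_nat ?leqnSn ?(leq_trans _ x2).
case: ifP => [xD|_].
  have : ln (3 : R) <= ln x.+1%:R by rewrite ler_ln ?posrE ?ltr0n ?ler_nat.
  move=> lx; apply: le_trans xD _; rewrite ler_peMr; lra.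
rewrite ler_pM2l; last lra.
(* Here [D >= 3] makes the constant [1 - ln D] of the potential nonpositive. *)
have : ln (3 : R) <= ln D by rewrite ler_ln ?posrE; lra.
lra.
Qed.

(** Two elements are excluded because then [DEN] is 1, and the one query that separates them exceeds
    [ln 2]. *)
Lemma ammrs_size (R : realType) (m : nat) (a : bits m) (A B : {set bits m})
    (js : seq 'I_m) :
  a \in A -> ammrs a A js B -> #|A| <> 2%N ->
  (size js)%:R <= DEN R A * ln #|A|%:R.
Proof.
move=> aA run n2.
have n0 : (0 < #|A|)%N by apply/card_gt0P; exists a.
have [n1|n3] := leqP #|A| 2.
  have := ammrs_potential (id_potential (DEN R A)) (subxx A) aA run.
  have -> : #|A| = 1%N by move: n0 n1 n2; case: #|A| => [|[|[|]]].
  by rewrite ln1 mulr0.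
have [F FP Fle] := potential_exists (DEN_ge2 R n3).
apply: le_trans (ammrs_potential FP (subxx A) aA run) _.
by have := Fle #|A|.-1; rewrite prednK //; apply; rewrite -ltnS prednK.
Qed.

Lemma DEN_gt0 (R : realType) (m : nat) (A : {set bits m}) : (2 <= #|A|)%N -> 0 < DEN R A.
Proof.
move=> A2; have := card_le_DEN R (subxx A) A2.
rewrite lt_neqAle DEN_ge0 andbT; apply: contraTneq => <-.
by rewrite mul0r -ltNge subr_gt0 ltr1n.
Qed.

(** Rounding up also covers two elements: the bound is positive, so its ceiling allows the single
    query. *)
Lemma ammrs_size_ceil (R : realType) (m : nat) (a : bits m) (A B : {set bits m})
    (js : seq 'I_m) :
  a \in A -> ammrs a A js B ->
  (size js)%:Z <= Num.ceil (DEN R A * ln #|A|%:R).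
Proof.
move=> aA run; have := Num.Theory.ceil_ge (DEN R A * ln #|A|%:R).
have [n2|/eqP n2] := eqVneq #|A| 2; last first.
  by move=> /(le_trans (ammrs_size R aA run n2)); rewrite -(ler_int R) pmulrn.
move=> _; apply: (@le_trans _ _ 1).
  have := ammrs_potential (id_potential (DEN R A)) (subxx A) aA run.
  by rewrite n2 ler_nat lez_nat.
rewrite -gtz0_ge1 ceil_gt0 mulr_gt0 ?DEN_gt0 ?n2 //.
by have := ln2_ge R; lra.
Qed.

Theorem theorem3 (R : realType) :
  (exists (p : cmd) (C : nat),
     forall (m n : nat) (A : {set bits m}) (s : seq (bits m)) (a : bits m),
       (0 < m)%N -> #|A| = n -> uniq s -> s =i A -> a \in A ->
       exists (t : nat) (js : seq 'I_m) (st : state),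
         [/\ exec (C * (m * n))%N a p (input_state s) t js st,
             (t <= C * (m * n))%N,
             ammrs a A js [set a]
           & reg st 0%N = index a s])
  /\
  (forall (m n : nat) (A : {set bits m}), #|A| = n ->
     [/\ forall (a : bits m) (js : seq 'I_m) (B : {set bits m}),
           a \in A -> ammrs a A js B ->
           [/\ B = [set a] \/ (exists j B', ammrs_step a B j B'),
               n <> 2%N -> (size js)%:R <= DEN R A * ln n%:R
             & (size js)%:Z <= Num.ceil (DEN R A * ln n%:R)],
         DEN R A * ln n%:R
           <= Num.min (ln 2 * DEN R A) (ln n%:R) * (OPT A)%:R
       & Num.min (ln 2 * DEN R A) (ln n%:R) * (OPT A)%:R
           <= Num.min (ln 2 * ((ETD A)%:R + 1)) (ln n%:R) * (OPT A)%:R]).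
Proof.
split.
  exists ammrs_prog, 500 => m n A s a m0 <- us sA aA.
  have [t [js [st [run [tE X rE]]]]] := exec_ammrs_prog m0 us sA aA.
  by exists t, js, st.
move=> m n A <-; split.
- move=> a js B aA run; split.
  + exact: ammrs_status run.
  + exact: ammrs_size run.
  + exact: ammrs_size_ceil run.
- have l2 := ln2_ge R.
  (* Each argument of the minimum needs one factor replaced: [ln n] by [ln 2 * OPT] for the first,
     [DEN] by [OPT] for the second. *)
  have DO : DEN R A <= (OPT A)%:R := DEN_le_nat R (@card_MAMI_OPT _ _).
  have ln_n : ln #|A|%:R <= ln 2 * (OPT A)%:R :> R.
    (* For empty [A] the convention [ln 0 = 0] applies. *)
    have [->|n0] := posnP #|A|; first by rewrite ln0 // mulr_ge0 //; lra.
    rewrite mulr_natr -lnXn // ler_ln ?posrE ?ltr0n ?exprn_gt0 //.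
    by rewrite -natrX ler_nat card_OPT.
  have lnA : 0 <= ln (#|A|%:R : R).
    by have [->|n0] := posnP #|A|; [rewrite ln0|rewrite ln_ge0 // ler1n].
  rewrite /Num.min; case: ifP => _.
    by rewrite [ln 2 * _]mulrC -mulrA ler_wpM2l ?DEN_ge0.
  by rewrite mulrC ler_wpM2l.
- have DE : DEN R A <= (ETD A)%:R := DEN_le_nat R (@card_MAMI_ETD _ _).
  rewrite ler_wpM2r // le_min2 // ler_wpM2l //; last lra.
  by have := ln2_ge R; lra.
Qed.
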